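(* Let $C,\gamma>0$. There exist constants $C_{\rm LU}>0$ and $p>2$ (depending only on $C,\gamma$) such that for every $n\in\mathbb{N}$ and every $M\in\mathbb{R}^{n\times n}$ with $\|M\|_{S_\infty}\le C$ and $\max_{1\le j\le n}\|(M|_{j\times j})^{-1}\|_{S_\infty}\le1/\gamma$, $M$ has an $LU$-factorization $M=LU$ with $L$ unit lower triangular ($L_{ii}=1$) and $U$ upper triangular satisfying $$\|L\|_{S_\infty}+\|U\|_{S_\infty}+\|L^{-1}\|_{S_\infty}+\|U^{-1}\|_{S_\infty}\le C_{\rm LU}\,n^{1/p}.$$
   Context: $\|\cdot\|_{S_\infty}$ denotes the spectral norm; $M|_{j\times j}$ is the upper left $j\times j$ submatrix of $M$ (assumed invertible for all $j$). *)

(* Defs.v *)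
From HB Require Import structures.
From mathcomp Require Import all_boot all_order all_algebra.
From mathcomp Require Import all_classical all_reals.
From mathcomp Require Import exp.
Set Implicit Arguments. Unset Strict Implicit. Unset Printing Implicit Defensive.
Import Order.TTheory GRing.Theory Num.Theory.
Local Open Scope ring_scope.
Local Open Scope classical_set_scope.

Definition vnorm2 {R : realType} {n : nat} (x : 'cV[R]_n) : R :=
  Num.sqrt (\sum_(i < n) x i 0 ^+ 2).

Definition specnorm {R : realType} {m n : nat} (A : 'M[R]_(m, n)) : R :=
  sup [set vnorm2 (A *m x) | x in [set x : 'cV[R]_n | vnorm2 x <= 1]].

Definition lead_sub {R : Type} {n : nat} (M : 'M[R]_n) (j : 'I_n) : 'M[R]_(j.+1) :=
  \matrix_(a < j.+1, b < j.+1) M (widen_ord (ltn_ord j) a) (widen_ord (ltn_ord j) b).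

(* Main.v *)
(** Let [L = M Z] with [Z = U^-1] upper triangular. If [x] is supported in an interval [I] of
    indices then [y = L x] vanishes above [I] and [z = Z x] vanishes below it, so [z] is the
    image of the part of [y] in [I] under the inverse of a leading principal submatrix, and
    [|y| <= C |z| <= (C / gamma) |P_I y|]: a fixed fraction of the energy of [L x] stays in [I].
    This property improves the trivial bound [sqrt n]. When an interval is cut into [q] pieces,
    the images of the pieces cannot all be nearly parallel, since a common direction cannot
    have a fixed fraction of its energy in each of many disjoint intervals; hence the squared
    operator norm grows by a factor [theta q] with [theta < 1] when the length of the intervals
    is multiplied by [q], which gives [|L|^2 <= c n^alpha] with [alpha < 1].
    The same argument for [M^T] bounds [U^T], and [U^-1 = M^-1 L], [L^-1 = U M^-1]. *)

Require Import Defs.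
From HB Require Import structures.
From mathcomp Require Import all_boot all_order all_algebra.
From mathcomp Require Import all_classical all_reals.
From mathcomp Require Import exp.
From mathcomp Require Import ring lra zify.
Import Order.TTheory GRing.Theory Num.Theory.
Local Open Scope ring_scope.

(** * Inner products, squared norms and projections onto index intervals *)

Definition dotv {R : realType} {n : nat} (x y : 'cV[R]_n) : R :=
  \sum_(i < n) x i 0 * y i 0.

(** The interval is half-open and the ambient dimension is kept. The endpoints are arbitrary
    naturals, so an interval may overhang [n] and its length can be an exact power of [q.+1]. *)
Definition proj {R : realType} {n : nat} (a b : nat) (x : 'cV[R]_n) : 'cV[R]_n :=
  \col_i (if (a <= i < b)%N then x i 0 else 0).

Notation sqn x := (dotv x x).

Section EuclideanVectors.
Variables (R : realType) (n : nat).
Implicit Types (x y z : 'cV[R]_n) (c : R).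

Lemma dotvC x y : dotv x y = dotv y x.
Proof. by apply: eq_bigr => i _; rewrite mulrC. Qed.

Lemma dotvDl x y z : dotv (x + y) z = dotv x z + dotv y z.
Proof. by rewrite -big_split; apply: eq_bigr => i _ /=; rewrite mxE mulrDl. Qed.

Lemma dotvDr x y z : dotv z (x + y) = dotv z x + dotv z y.
Proof. by rewrite dotvC dotvDl !(dotvC z). Qed.

Lemma dotvZl c x y : dotv (c *: x) y = c * dotv x y.
Proof. by rewrite mulr_sumr; apply: eq_bigr => i _; rewrite mxE mulrA. Qed.

Lemma dotvZr c x y : dotv x (c *: y) = c * dotv x y.
Proof. by rewrite dotvC dotvZl dotvC. Qed.

Lemma dotv0l x : dotv 0 x = 0.
Proof. by rewrite -(scale0r x) dotvZl mul0r. Qed.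

Lemma dotv_suml q (v : 'I_q -> 'cV[R]_n) x :
  dotv (\sum_i v i) x = \sum_i dotv (v i) x.
Proof. by apply: (big_morph (fun u => dotv u x)) => [u w|]; rewrite (dotvDl, dotv0l). Qed.

Lemma dotvE x y : dotv x y = (x^T *m y) 0 0.
Proof. by rewrite mxE; apply: eq_bigr => i _; rewrite mxE. Qed.

Lemma sqn_ge0 x : 0 <= sqn x.
Proof. by apply: sumr_ge0 => i _; rewrite -expr2 sqr_ge0. Qed.

Lemma sqnZ c x : sqn (c *: x) = c ^+ 2 * sqn x.
Proof. by rewrite dotvZl dotvZr mulrA. Qed.

Lemma sqn_entry x i : x i 0 ^+ 2 <= sqn x.
Proof.
rewrite /dotv (bigD1 i) //= -expr2 lerDl.
by apply: sumr_ge0 => k _; rewrite -expr2 sqr_ge0.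
Qed.

Lemma sqnD_le x y : sqn (x + y) <= 2 * sqn x + 2 * sqn y.
Proof.
have := sqn_ge0 (x + (-1) *: y).
rewrite !(dotvDl, dotvDr) sqnZ dotvZl dotvZr (dotvC y x); lra.
Qed.

Lemma dotv_CauchySchwarz x y : dotv x y ^+ 2 <= sqn x * sqn y.
Proof.
have h : 0 <= sqn y * (sqn y * sqn x - dotv x y ^+ 2).
  have := sqn_ge0 (sqn y *: x + (- dotv x y) *: y).
  by rewrite !(dotvDl, dotvDr, dotvZl, dotvZr) (dotvC y x); lra.
have [y0|] := eqVneq (sqn y) 0; last first.
  by move=> yn0; move: h; rewrite pmulr_rge0 ?lt0r ?yn0 ?sqn_ge0 // mulrC subr_ge0.
have z i : y i 0 = 0.
  by apply/eqP; rewrite -sqrf_eq0 eq_le sqr_ge0 -{1}y0 sqn_entry.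
by rewrite y0 mulr0 /dotv big1 ?expr0n // => i _; rewrite z mulr0.
Qed.

Lemma sqn_proj a b x :
  sqn (proj a b x) = \sum_(i < n | (a <= i < b)%N) x i 0 ^+ 2.
Proof.
rewrite [RHS]big_mkcond; apply: eq_bigr => i _; rewrite mxE.
by case: ifP; rewrite ?mulr0 // expr2.
Qed.

Lemma sqn_proj1 (k : 'I_n) x : sqn (proj k k.+1 x) = x k 0 ^+ 2.
Proof.
rewrite sqn_proj (bigD1 k) /=; last by rewrite leqnn ltnSn.
rewrite big1 ?addr0 // => i /andP[/andP[ki ik] /eqP []].
by apply/val_inj/eqP; rewrite /= eqn_leq ki andbT.
Qed.

Lemma sqn_proj_le a b x : sqn (proj a b x) <= sqn x.
Proof.
by apply: ler_sum => i _; rewrite mxE; case: ifP => // _; rewrite mulr0 -expr2 sqr_ge0.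
Qed.

Lemma proj_id a b x :
  (forall i : 'I_n, ~~ (a <= i < b)%N -> x i 0 = 0) -> proj a b x = x.
Proof.
move=> h; apply/colP => i; rewrite mxE; by case: ifP => // /negbT /h ->.
Qed.

Lemma projD a b x y : proj a b (x + y) = proj a b x + proj a b y.
Proof. by apply/colP => i; rewrite !mxE; case: ifP => // _; rewrite addr0. Qed.

Lemma proj_cat (a b c : nat) x : (a <= b)%N -> (b <= c)%N ->
  proj a c x = proj a b x + proj b c x.
Proof.
move=> ab bc; apply/colP => i; rewrite !mxE.
case: (leqP a i) => ai; case: (ltnP i b) => ib; case: (ltnP i c) => ic;
  rewrite /= ?addr0 ?add0r //; exfalso; lia.
Qed.

Lemma sqn_proj_cat (a b c : nat) x : (a <= b)%N -> (b <= c)%N ->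
  sqn (proj a c x) = sqn (proj a b x) + sqn (proj b c x).
Proof.
move=> ab bc; rewrite -big_split; apply: eq_bigr => i _; rewrite !mxE.
case: (leqP a i) => ai; case: (ltnP i b) => ib; case: (ltnP i c) => ic;
  rewrite /= ?mulr0 ?addr0 ?add0r //; exfalso; lia.
Qed.

Lemma proj_sum a h q x :
  proj a (a + q * h)%N x = \sum_(i < q) proj (a + i * h)%N (a + i.+1 * h)%N x.
Proof.
elim: q => [|q IH].
  by rewrite big_ord0 mul0n addn0; apply/colP => i; rewrite !mxE ltnNge andbN.
rewrite big_ord_recr /= -IH; apply: proj_cat; lia.
Qed.

Lemma sqn_proj_sum a h q x :
  sqn (proj a (a + q * h)%N x) =
    \sum_(i < q) sqn (proj (a + i * h)%N (a + i.+1 * h)%N x).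
Proof.
elim: q => [|q IH].
  rewrite big_ord0 mul0n addn0 sqn_proj big_pred0 // => i.
  by rewrite ltnNge andbN.
rewrite big_ord_recr /= -IH; apply: sqn_proj_cat; lia.
Qed.

(** Variance identity about the mean of the [v i]. It measures how far the pieces are from being
    copies of one common vector. *)
Lemma sum_sqn_deviation q (v : 'I_q.+1 -> 'cV[R]_n) :
  \sum_i sqn (v i + (- q.+1%:R^-1) *: \sum_j v j) =
    \sum_i sqn (v i) - sqn (\sum_j v j) / q.+1%:R.
Proof.
set S := \sum_j v j.
have e i : sqn (v i + (- q.+1%:R^-1) *: S) =
    sqn (v i) + ((- (2 * q.+1%:R^-1)) * dotv (v i) S + q.+1%:R^-1 ^+ 2 * sqn S).
  by rewrite !(dotvDl, dotvDr, dotvZl, dotvZr) (dotvC S); ring.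
rewrite (eq_bigr _ (fun i _ => e i)) !big_split /= -mulr_sumr -dotv_suml -/S.
rewrite sumr_const card_ord -[(_ * sqn S) *+ q.+1]mulr_natr.
have q0 : (q.+1%:R : R) != 0 by rewrite pnatr_eq0.
by move: (q.+1%:R : R) q0 => Q q0; field.
Qed.

End EuclideanVectors.

(** * Growth of a matrix on intervals under the energy property *)

Definition gain {R : realType} (kappa : R) : R := (4 * kappa - 2) / (4 * kappa - 1).

Lemma gain_ge0 (R : realType) (kappa : R) : 1 <= kappa -> 0 <= gain kappa.
Proof. by move=> k1; apply: divr_ge0; lra. Qed.

(** Clearing denominators gives [2 * kappa * (Q - 1) * s <= (2 * kappa - 1) * Q ^+ 2 * X]. Since
    [4 * kappa <= Q], the term [2 * kappa * s] is absorbed into [Q * s / 2]. The quotient of the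
    remaining coefficients is [gain kappa], which is less than 1. *)
Lemma gain_absorb (R : realType) (kappa Q s X : R) :
  1 <= kappa -> 4 * kappa <= Q -> 0 <= s ->
  X <= kappa * (2 * (X - s / Q) + 2 * (s / Q ^+ 2)) -> s <= gain kappa * Q * X.
Proof.
move=> k1 kQ s0 hI; have q0 : 0 < Q by lra.
have hs : (4 * kappa - 1) * s <= (4 * kappa - 2) * Q * X.
  have := hI; rewrite -(ler_pM2r (exprn_gt0 2 q0)).
  have -> : kappa * (2 * (X - s / Q) + 2 * (s / Q ^+ 2)) * Q ^+ 2 =
            kappa * (2 * (X * Q ^+ 2 - s * Q) + 2 * s) by field; lra.
  move=> hI2; have h4 : 0 <= s * (Q - 4 * kappa) by rewrite mulr_ge0 //; lra.
  have h5 : (4 * kappa - 1) * s * Q <= (4 * kappa - 2) * Q * X * Q by lra.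
  by move: h5; rewrite ler_pM2r.
rewrite -(@ler_pM2l _ (4 * kappa - 1)); last lra.
apply: le_trans hs _; rewrite le_eqVlt; apply/orP; left; apply/eqP.
by rewrite /gain; field; lra.
Qed.

Section IntervalGrowth.
Variables (R : realType) (n : nat) (A : 'M[R]_n) (kappa K : R) (q : nat).
Hypotheses (kappa_ge1 : 1 <= kappa) (q_ge : 4 * kappa <= q.+1%:R) (K_ge0 : 0 <= K).
Hypothesis interval_energy : forall a b x,
  sqn (A *m proj a b x) <= kappa * sqn (proj a b (A *m proj a b x)).
Hypothesis col_bound : forall k, sqn (col k A) <= K.

(** Each image [v i] of a piece is split into the mean [S / q.+1] and a deviation [w i]. Restricted
    to the disjoint intervals, the deviations have at most their full energy, given by the variance
    identity, while the mean contributes at most its own energy once, not [q.+1] times. This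
    improves the factor [q.+1] of the triangle inequality by [gain kappa]. *)
Lemma sqn_interval_step a h F x : 0 <= F ->
  (forall b y, sqn (A *m proj b (b + h)%N y) <= F * sqn (proj b (b + h)%N y)) ->
  sqn (A *m proj a (a + q.+1 * h)%N x) <=
    (gain kappa * q.+1%:R * F) * sqn (proj a (a + q.+1 * h)%N x).
Proof.
move=> F0 hF; rewrite [X in A *m X]proj_sum mulmx_sumr.
pose I (i : 'I_q.+1) := proj (a + i * h)%N (a + i.+1 * h)%N : 'cV[R]_n -> 'cV[R]_n.
pose v i := A *m I i x.
set S := \sum_i v i; rewrite -[X in dotv X X <= _]/S.
have hX : \sum_i sqn (v i) <= F * sqn (proj a (a + q.+1 * h)%N x).
  rewrite sqn_proj_sum mulr_sumr; apply: ler_sum => i _.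
  by rewrite /v /I (_ : a + i.+1 * h = a + i * h + h)%N; [apply: hF | lia].
set X := \sum_i sqn (v i) in hX.
have q0 : (0 : R) < q.+1%:R by rewrite ltr0n.
have hI : X <= kappa * (2 * (X - sqn S / q.+1%:R) + 2 * (sqn S / q.+1%:R ^+ 2)).
  rewrite /X -sum_sqn_deviation -/S.
  apply: (@le_trans _ _ (kappa * \sum_i sqn (I i (v i)))).
    by rewrite mulr_sumr; apply: ler_sum => i _; apply: interval_energy.
  rewrite (ler_pM2l (lt_le_trans ltr01 kappa_ge1)).
  pose w i := v i + (- q.+1%:R^-1) *: S.
  have h1 : \sum_i sqn (I i (v i)) <=
      \sum_i (2 * sqn (w i) + 2 * sqn (I i (q.+1%:R^-1 *: S))).
    apply: ler_sum => i _.
    have -> : v i = w i + q.+1%:R^-1 *: S by rewrite /w scaleNr subrK.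
    rewrite /I projD; apply: le_trans (sqnD_le _ _ _ _) _.
    by rewrite lerD2r ler_pM2l ?ltr0n // sqn_proj_le.
  apply: le_trans h1 _; rewrite big_split /= -!mulr_sumr -/w lerD2l ler_pM2l ?ltr0n //.
  rewrite -sqn_proj_sum; apply: le_trans (sqn_proj_le _ _ _ _ _) _.
  by rewrite sqnZ exprVn mulrC.
apply: (@le_trans _ _ (gain kappa * q.+1%:R * X)).
  exact: (gain_absorb _ _ _ _ _ kappa_ge1 q_ge (sqn_ge0 _ _ S) hI).
by rewrite -[leRHS]mulrA ler_wpM2l // mulr_ge0 ?gain_ge0 // ltW.
Qed.

Lemma sqn_interval_pow t a x :
  sqn (A *m proj a (a + q.+1 ^ t)%N x) <=
    (K * (gain kappa * q.+1%:R) ^+ t) * sqn (proj a (a + q.+1 ^ t)%N x).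
Proof.
elim: t a x => [|t IH] a x.
  rewrite expn0 addn1 expr0 mulr1.
  (* A unit interval starting at or beyond [n] contains no index; otherwise the projection is a
     multiple of a basis vector and [col_bound] applies. *)
  have [an|na] := ltnP a n; last first.
    have -> : proj a a.+1 x = 0.
      by apply/colP => i; rewrite !mxE; case: ifP => //; have := ltn_ord i; lia.
    by rewrite mulmx0 dotv0l mulr0.
  have e : proj a a.+1 x = x (Ordinal an) 0 *: delta_mx (Ordinal an) 0.
    apply/colP => i; rewrite !mxE eqxx andbT -[(a <= i < a.+1)%N]/((a <= i) && (i <= a))%N.
    rewrite -eqn_leq eq_sym -[(i : nat) == a]/(i == Ordinal an).
    by case: eqP => [->|]; rewrite ?mulr1 ?mulr0.
  have d1 : sqn (delta_mx (Ordinal an) 0 : 'cV[R]_n) = 1.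
    by rewrite dotvE trmx_delta mul_delta_mx mxE !eqxx.
  rewrite e -scalemxAr -colE !sqnZ d1 mulr1 mulrC ler_wpM2r ?sqr_ge0 //.
rewrite exprS expnS; apply: le_trans (sqn_interval_step a _ _ x _ IH) _.
  by rewrite mulr_ge0 // exprn_ge0 // mulr_ge0 ?gain_ge0.
by rewrite le_eqVlt; apply/orP; left; apply/eqP; ring.
Qed.

Lemma sqn_mul_pow t x : (n <= q.+1 ^ t)%N ->
  sqn (A *m x) <= (K * (gain kappa * q.+1%:R) ^+ t) * sqn x.
Proof.
move=> nt; have := sqn_interval_pow t 0 x; rewrite add0n proj_id // => i.
by have := ltn_ord i; lia.
Qed.

End IntervalGrowth.

(** * Spectral norm and homogeneous quadratic bounds *)

Section SpectralNorm.
Variables (R : realType) (m n : nat).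
Implicit Types (A : 'M[R]_(m, n)) (c : R).

Lemma vnorm2E k (x : 'cV[R]_k) : vnorm2 x = Num.sqrt (sqn x).
Proof. by []. Qed.

(** Frobenius bound. Its only purpose is to make the set in [specnorm] bounded above, so that [sup]
    is a genuine supremum, and to settle vectors of norm zero. *)
Lemma sqn_mul_bounded A : exists2 c, 0 <= c & forall x, sqn (A *m x) <= c * sqn x.
Proof.
exists (\sum_i sqn (row i A)^T) => [|x]; first by apply: sumr_ge0 => i _; apply: sqn_ge0.
rewrite mulr_suml; apply: ler_sum => i _.
have -> : (A *m x) i 0 = dotv (row i A)^T x.
  by rewrite mxE; apply: eq_bigr => k _; rewrite !mxE.
by rewrite -expr2 dotv_CauchySchwarz.
Qed.

Lemma specnorm_le A c : 0 <= c ->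
  (forall x, sqn (A *m x) <= c ^+ 2 * sqn x) -> specnorm A <= c.
Proof.
move=> c0 h; apply: ge_sup.
  by exists (vnorm2 (A *m 0)); exists 0 => //=; rewrite vnorm2E dotv0l sqrtr0 ler01.
move=> _ [x /= hx <-]; rewrite vnorm2E -(ger0_norm c0) -sqrtr_sqr ler_wsqrtr //.
apply: le_trans (h x) _; rewrite -[leRHS]mulr1 ler_wpM2l ?sqr_ge0 //.
by move: hx; rewrite vnorm2E -{1}sqrtr1 ler_sqrt.
Qed.

Lemma sqn_mul_le A c x : specnorm A <= c -> sqn (A *m x) <= c ^+ 2 * sqn x.
Proof.
have [F F0 hF] := sqn_mul_bounded A => hc.
have ub y : vnorm2 y <= 1 -> vnorm2 (A *m y) <= c.
  move=> hy; apply: le_trans hc; apply: ub_le_sup; last by exists y.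
  exists (Num.sqrt F) => _ [z /= hz <-]; rewrite vnorm2E ler_wsqrtr //.
  apply: le_trans (hF z) _; rewrite -[leRHS]mulr1 ler_wpM2l //.
  by move: hz; rewrite vnorm2E -{1}sqrtr1 ler_sqrt.
have [x0|xn0] := eqVneq (sqn x) 0.
  by apply: le_trans (hF x) _; rewrite x0 !mulr0.
have xp : 0 < sqn x by rewrite lt0r xn0 sqn_ge0.
have hs : (Num.sqrt (sqn x))^-1 ^+ 2 = (sqn x)^-1 by rewrite exprVn sqr_sqrtr ?sqn_ge0.
have := ub ((Num.sqrt (sqn x))^-1 *: x).
rewrite !vnorm2E -scalemxAr !sqnZ hs mulVf // sqrtr1 lexx => /(_ isT) h.
have c0 : 0 <= c by apply: le_trans h; apply: sqrtr_ge0.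
move: h; rewrite -{1}(ger0_norm c0) -sqrtr_sqr ler_sqrt ?sqr_ge0 //.
by rewrite mulrC ler_pdivrMr.
Qed.

End SpectralNorm.

(** With [y = A^T x], the square of [sqn y] is that of the product of [x] with [A y]. Cauchy-Schwarz
    bounds it by [sqn x * (c * sqn y)], and one factor [sqn y] cancels. *)
Lemma sqn_mul_trmx (R : realType) m n (A : 'M[R]_(m, n)) (c : R) : 0 <= c ->
  (forall x, sqn (A *m x) <= c * sqn x) -> forall x, sqn (A^T *m x) <= c * sqn x.
Proof.
move=> c0 h x; set y := A^T *m x.
have [y0|yn0] := eqVneq (sqn y) 0; first by rewrite y0 mulr_ge0 // sqn_ge0.
have yp : 0 < sqn y by rewrite lt0r yn0 sqn_ge0.
have e : sqn y = dotv x (A *m y) by rewrite !dotvE mulmxA [y^T]trmx_mul trmxK.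
rewrite -(ler_pM2r yp) -expr2 {1}e; apply: le_trans (dotv_CauchySchwarz _ _ _ _) _.
by rewrite [c * _]mulrC -mulrA ler_wpM2l ?sqn_ge0.
Qed.

(** * Stability on initial segments from the leading blocks *)

Definition stable_below {R : realType} {n : nat} (M : 'M[R]_n) (g : R) :=
  forall (b : nat) (z : 'cV[R]_n), (forall i : 'I_n, (b <= i)%N -> z i 0 = 0) ->
  sqn z <= g * sqn (proj 0 b (M *m z)).

(** For [z] supported in the first [b] indices, the first [b] entries of [M z] are the leading block
    applied to [z], so the inverse bound for the block applies. The conclusion stays in dimension
    [n], which avoids matrices of varying size later on. *)
Lemma lead_sub_stable_below (R : realType) n (M : 'M[R]_n) (g : R) : 0 <= g ->
  (forall j, lead_sub M j \in unitmx) ->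
  (forall j x, sqn (invmx (lead_sub M j) *m x) <= g * sqn x) ->
  stable_below M g.
Proof.
move=> g0 hu hg.
have main (j : 'I_n) (z : 'cV[R]_n) : (forall i : 'I_n, (j < i)%N -> z i 0 = 0) ->
    sqn z <= g * sqn (proj 0 j.+1 (M *m z)).
  move=> hz; pose w := widen_ord (ltn_ord j).
  pose z' : 'cV[R]_j.+1 := \col_a z (w a) 0.
  have narrow (F : 'I_n -> R) : \sum_(i < n | (0 <= i < j.+1)%N) F i = \sum_a F (w a).
    by rewrite (big_ord_narrow (ltn_ord j)).
  have ez : sqn z = sqn z'.
    rewrite -{1 2}(proj_id _ _ 0 j.+1 z) ?sqn_proj ?narrow; last first.
      by move=> i; rewrite /= -leqNgt; apply: hz.
    by apply: eq_bigr => a _; rewrite !mxE expr2.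
  have eM a : (lead_sub M j *m z') a 0 = (M *m z) (w a) 0.
    rewrite !mxE (bigID (fun i : 'I_n => (0 <= i < j.+1)%N)) /= narrow.
    rewrite [X in _ + X]big1 ?addr0 => [|i].
      by apply: eq_bigr => b _; rewrite !mxE.
    by rewrite -leqNgt => ji; rewrite hz // mulr0.
  have -> : sqn (proj 0 j.+1 (M *m z)) = sqn (lead_sub M j *m z').
    by rewrite sqn_proj narrow; apply: eq_bigr => a _; rewrite eM expr2.
  by rewrite ez -{1 2}(mulKmx (hu j) z'); apply: hg.
(* Only blocks of size between 1 and [n] come from some [j]. A larger [b] is cut down to [n], and an
   empty segment forces [z = 0]. *)
move=> b z hz; have [b0|b0] := posnP (minn b n).
  have -> : z = 0; last by rewrite dotv0l mulr_ge0 ?sqn_ge0.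
  by apply/colP => i; rewrite mxE hz //; have := ltn_ord i; lia.
have jn : ((minn b n).-1 < n)%N by lia.
have -> : proj 0 b (M *m z) = proj 0 (Ordinal jn).+1 (M *m z).
  apply/colP => i; rewrite [LHS]mxE [RHS]mxE; congr (if _ then _ else _).
  by have := ltn_ord i; rewrite /=; lia.
by apply: main => i /= ji; apply: hz; have := ltn_ord i; lia.
Qed.

(** * Lower triangular products [N Z], used for L = M U^-1 and U^T = M^T (L^-1)^T *)

Section LowerTriangular.
Variables (R : realType) (n : nat) (N Z : 'M[R]_n) (c g : R).
Hypotheses (c_ge0 : 0 <= c) (g_ge0 : 0 <= g).
Hypothesis N_bound : forall x, sqn (N *m x) <= c * sqn x.
Hypothesis N_stable : stable_below N g.
Hypothesis Z_upper : forall i j : 'I_n, (j < i)%N -> Z i j = 0.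
Hypothesis NZ_lower : forall i j : 'I_n, (i < j)%N -> (N *m Z) i j = 0.

Lemma lower_factor_interval_energy a b x :
  sqn (N *m Z *m proj a b x) <= (1 + c * g) * sqn (proj a b (N *m Z *m proj a b x)).
Proof.
set x' := proj a b x; set y := N *m Z *m x'.
have hz (i : 'I_n) : (b <= i)%N -> (Z *m x') i 0 = 0.
  move=> bi; rewrite mxE big1 // => k _; rewrite !mxE.
  case: ifP => [/andP[_ kb]|_]; last by rewrite mulr0.
  by rewrite Z_upper ?mul0r //; apply: leq_trans bi.
have hy (i : 'I_n) : (i < a)%N -> y i 0 = 0.
  move=> ia; rewrite mxE big1 // => k _; rewrite [x' k 0]mxE.
  case: ifP => [/andP[ak _]|_]; last by rewrite mulr0.
  by rewrite NZ_lower ?mul0r //; apply: leq_trans ak.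
have -> : proj a b y = proj 0 b y.
  apply/colP => i; rewrite !mxE /=; case: (ltnP i a) => [/hy|//] /= e.
  by move: e; rewrite mxE => ->; case: ifP.
have e : y = N *m (Z *m x') by rewrite mulmxA.
(* The argument yields the constant [c * g]; adding 1 makes it at least 1, as the growth estimate
   requires. *)
apply: (@le_trans _ _ (c * g * sqn (proj 0 b y))); last first.
  by rewrite mulrDl mul1r lerDr sqn_ge0.
rewrite -mulrA {1 2}e; apply: le_trans (N_bound _) _.
by rewrite ler_wpM2l // e N_stable.
Qed.

(** The energy property for the single index [k]: a fixed fraction of the energy of a column sits in
    its diagonal entry. *)
Lemma lower_factor_col_bound k :
  sqn (col k (N *m Z)) <= (1 + c * g) * (N *m Z) k k ^+ 2.
Proof.
have e : proj k k.+1 (delta_mx k 0 : 'cV[R]_n) = delta_mx k 0.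
  apply: proj_id => i; rewrite !mxE andbT => ik; case: eqP => // ki.
  by move: ik; rewrite ki leqnn ltnSn.
have := lower_factor_interval_energy k k.+1 (delta_mx k 0); rewrite e -colE.
move/le_trans; apply; by rewrite sqn_proj1 mxE ler_wpM2l ?addr_ge0 ?mulr_ge0.
Qed.

(** The column [z] of [Z] satisfies [N z = 0] before [k], so there the images of its head and of its
    entry at [k] cancel. Stability then bounds the head by [Z k k], hence all of [z]. As [N z] has
    entry 1 at [k], [Z k k] cannot be small. This will bound the pivots of U from above. *)
Lemma upper_factor_diag_bound k : (N *m Z) k k = 1 ->
  1 <= c * (1 + g * c) * Z k k ^+ 2.
Proof.
move=> L1; set z := col k Z.
have Nz i : (N *m z) i 0 = (N *m Z) i k by rewrite !mxE; apply: eq_bigr => l _; rewrite mxE.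
have e1 : z = proj 0 k z + proj k k.+1 z.
  rewrite -proj_cat // proj_id // => i /=; rewrite -leqNgt => ki.
  by rewrite mxE Z_upper.
have e2 : sqn (proj k k.+1 z) = Z k k ^+ 2 by rewrite sqn_proj1 mxE.
have h1 : sqn (proj 0 k z) <= g * (c * Z k k ^+ 2).
  apply: le_trans (N_stable k (proj 0 k z) _) _ => [i ki|].
    by rewrite mxE /= ltnNge ki.
  rewrite ler_wpM2l //.
  have -> : proj 0 k (N *m proj 0 k z) = (-1) *: proj 0 k (N *m proj k k.+1 z).
    apply/eqP; rewrite scaleN1r -addr_eq0 -projD -mulmxDr -e1; apply/eqP/colP => i.
    by rewrite !mxE /=; case: ifP => // ik; have := Nz i; rewrite mxE => ->; rewrite NZ_lower.
  rewrite sqnZ sqrrN expr1n mul1r -e2.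
  by apply: le_trans (sqn_proj_le _ _ _ _ _) (N_bound _).
have h2 : sqn z <= (1 + g * c) * Z k k ^+ 2.
  rewrite -{1 2}(proj_id _ _ 0 k.+1 z); last first.
    by move=> i /=; rewrite -leqNgt => ki; rewrite mxE Z_upper.
  by rewrite (sqn_proj_cat _ _ 0 k) // e2 mulrDl mul1r addrC lerD2l -mulrA.
apply: (@le_trans _ _ (sqn (N *m z))).
  by apply: le_trans (sqn_entry _ _ _ k); rewrite Nz L1 expr1n.
by apply: le_trans (N_bound z) _; rewrite -mulrA ler_wpM2l.
Qed.

End LowerTriangular.

(** * Passage from powers of q to a power of n *)

Lemma interval_energy_growth (R : realType) (kappa : R) : 1 <= kappa ->
  exists alpha D : R, [/\ 0 < alpha, alpha < 1, 0 < D &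
  forall n (A : 'M[R]_n) (K : R), 0 <= K ->
    (forall a b x, sqn (A *m proj a b x) <= kappa * sqn (proj a b (A *m proj a b x))) ->
    (forall k, sqn (col k A) <= K) ->
    forall x, sqn (A *m x) <= K * (D * n%:R `^ alpha) * sqn x].
Proof.
move=> k1; pose q := Num.bound (4 * kappa); pose Q : R := q.+1%:R.
have kQ : 4 * kappa <= Q.
  rewrite ltW //; apply: lt_le_trans (archi_boundP _) _; first lra.
  by rewrite ler_nat.
pose T := gain kappa * Q.
have T1 : 1 < T.
  rewrite /T /gain mulrAC ltr_pdivlMr; last lra.
  have : 0 <= (4 * kappa - 2) * (Q - 4) by apply: mulr_ge0; lra.
  lra.
have TQ : T < Q.
  rewrite /T /gain mulrAC ltr_pdivrMr; last lra.
  lra.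
have lT : 0 < ln T by apply: ln_gt0.
have lTQ : ln T < ln Q by rewrite ltr_ln ?posrE //; lra.
(* Chosen so that Q to the power [alpha] equals [T]; it lies strictly between 0 and 1 because
   [1 < T < Q]. *)
pose alpha := ln T / ln Q.
have a0 : 0 < alpha by rewrite divr_gt0 //; lra.
have QaT : Q `^ alpha = T.
  rewrite /powR gt_eqF; last lra.
  by rewrite /alpha divfK ?lnK ?posrE ?gt_eqF //; lra.
exists alpha, T; split => //; [|lra|].
  by rewrite /alpha ltr_pdivrMr ?mul1r //; lra.
move=> n A K K0 hA hK x; have [n0|n0] := posnP n.
  move: A x {hA hK}; rewrite n0 => A x.
  rewrite [leLHS]big_ord0 mulr_ge0 ?sqn_ge0 // mulr_ge0 // mulr_ge0 ?powR_ge0 //.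
  lra.
(* Here Q^t lies between n and Q n, so T^t = (Q^t)^alpha <= Q^alpha n^alpha = T n^alpha. The last
   level overshoots by at most one factor, which is why [T] also serves as [D]. *)
pose t := (trunc_log q.+1 n).+1.
have q1 : (1 < q.+1)%N by rewrite -(ltr_nat R) -/Q; lra.
have nt : (n <= q.+1 ^ t)%N by rewrite ltnW // trunc_log_ltn.
apply: le_trans (sqn_mul_pow _ _ A kappa K q k1 kQ K0 hA hK t x nt) _.
rewrite ler_wpM2r ?sqn_ge0 // ler_wpM2l // -/Q -/T -QaT.
have Q0 : 0 <= Q by lra.
rewrite -powR_mulrn ?powR_ge0 // -powRrM mulrC powRrM powR_mulrn // -powRM ?ler0n //.
apply: (ge0_ler_powR (ltW a0)); rewrite ?nnegrE ?exprn_ge0 ?mulr_ge0 ?ler0n //.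
by rewrite /t exprS ler_wpM2l // -natrX ler_nat trunc_logP.
Qed.

(** * Triangular inverses and existence of the factorization *)

Lemma inverse_upper_triangular (F : fieldType) n (Z U : 'M[F]_n) :
  U *m Z = 1%:M -> (forall i j : 'I_n, (j < i)%N -> Z i j = 0) ->
  forall i j : 'I_n, (j < i)%N -> U i j = 0.
Proof.
move=> UZ hZ.
have dZ j : Z j j != 0.
  have [_] := mulmx1_unit UZ; rewrite unitmxE -det_tr det_trig; last first.
    by apply/is_trig_mxP => a b ab; rewrite mxE hZ.
  by rewrite unitfE => /prodf_neq0 /(_ j isT); rewrite mxE.
(* Strong induction on the column: in the entry [(i, j)] of [U Z = 1], terms with [k > j] vanish by
   [hZ] and those with [k < j] by induction, leaving [U i j * Z j j = 0]. *)
move=> i j; move: {2}(j : nat) (leqnn j) => m; elim: m j => [|m IH] j jm ji;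
  have := congr1 (fun A : 'M_n => A i j) UZ; rewrite !mxE (bigD1 j) //= big1 ?addr0.
- by rewrite gt_eqF // mulr0n => /eqP; rewrite mulf_eq0 (negPf (dZ j)) orbF => /eqP.
- move=> k kj; rewrite hZ ?mulr0 //; rewrite -val_eqE /= in kj; lia.
- by rewrite gt_eqF // mulr0n => /eqP; rewrite mulf_eq0 (negPf (dZ j)) orbF => /eqP.
move=> k kj; rewrite -val_eqE /= in kj; case: (ltnP j k) => jk; first by rewrite hZ ?mulr0.
by rewrite IH ?mul0r //; lia.
Qed.

(** The inverse of U is built first: column [k] of [Z] is the last column of the inverse of the
    leading block of size [k.+1], padded by zeros. Then [M Z] agrees with the identity on and above
    the diagonal, so it is unit lower triangular and serves as L. *)
Lemma LU_exists (R : realType) n (M : 'M[R]_n) :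
  (forall j, lead_sub M j \in unitmx) ->
  exists L U : 'M[R]_n, [/\ M = L *m U, forall i, L i i = 1,
    forall i j : 'I_n, (i < j)%N -> L i j = 0,
    forall i j : 'I_n, (j < i)%N -> U i j = 0 & L \in unitmx /\ U \in unitmx].
Proof.
move=> hM.
pose Z : 'M[R]_n := \matrix_(i, k)
  if (i <= k)%N then invmx (lead_sub M k) (inord i) ord_max else 0.
have hZ (i j : 'I_n) : (j < i)%N -> Z i j = 0 by move=> ji; rewrite mxE leqNgt ji.
have hL (i k : 'I_n) : (i <= k)%N -> (M *m Z) i k = (i == k)%:R.
  move=> ik; pose w := widen_ord (ltn_ord k).
  have ei : i = w (inord i) by apply/val_inj; rewrite /= inordK.
  have := congr1 (fun A : 'M_k.+1 => A (inord i) ord_max) (mulmxV (hM k)).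
  rewrite /= !mxE -val_eqE /= inordK // val_eqE => <-.
  rewrite (bigID (fun l : 'I_n => (l < k.+1)%N)) /= (big_ord_narrow (ltn_ord k)).
  rewrite [X in _ + X]big1 ?addr0 => [|l lk]; last by rewrite hZ ?mulr0 // ltnNge.
  apply: eq_bigr => l _; rewrite !mxE /= leq_ord -/w -ei.
  by congr (_ * invmx _ _ _); apply/val_inj; rewrite /= inordK.
have L1 i : (M *m Z) i i = 1 by rewrite hL // eqxx.
have L0 (i j : 'I_n) : (i < j)%N -> (M *m Z) i j = 0.
  by move=> ij; rewrite hL 1?ltnW // -val_eqE ltn_eqF.
have uL : M *m Z \in unitmx.
  rewrite unitmxE det_trig; last exact/is_trig_mxP.
  by rewrite big1 ?unitr1.
have uZ : Z \in unitmx by move: uL; rewrite unitmx_mul => /andP[].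
exists (M *m Z), (invmx Z); split => //; first by rewrite mulmxK.
  exact: inverse_upper_triangular (mulVmx uZ) hZ.
by rewrite unitmx_inv.
Qed.

(** * Assembly of the bounds for both factors and their inverses *)

Lemma lead_sub_trmx (T : Type) n (M : 'M[T]_n) j : lead_sub M^T j = (lead_sub M j)^T.
Proof. by apply/matrixP => a b; rewrite !mxE. Qed.

Lemma stable_below_sqn_le (R : realType) n (M : 'M[R]_n) (g : R) :
  stable_below M g -> forall z, sqn z <= g * sqn (M *m z).
Proof.
move=> st z; have := st n z; rewrite proj_id => [|i]; last by rewrite ltn_ord.
by apply=> i; rewrite leqNgt ltn_ord.
Qed.

Theorem mainTheorem8 (R : realType) (C gamma : R) (hC : 0 < C) (hg : 0 < gamma) :
  exists (CLU p : R), 0 < CLU /\ 2 < p /\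
  forall (n : nat) (M : 'M[R]_n),
    specnorm M <= C ->
    (forall j : 'I_n, lead_sub M j \in unitmx) ->
    (forall j : 'I_n, specnorm (invmx (lead_sub M j)) <= gamma^-1) ->
    exists L U : 'M[R]_n,
      M = L *m U /\
          (forall i : 'I_n, L i i = 1) /\
          (forall i j : 'I_n, (i < j)%N -> L i j = 0) /\
          (forall i j : 'I_n, (j < i)%N -> U i j = 0) /\
          L \in unitmx /\ U \in unitmx /\
          specnorm L + specnorm U + specnorm (invmx L) + specnorm (invmx U)
            <= CLU * (n%:R `^ p^-1).
Proof.
pose c := C ^+ 2; pose g := gamma^-1 ^+ 2; pose kappa := 1 + c * g.
have c0 : 0 <= c by apply: sqr_ge0.
have g0 : 0 <= g by apply: sqr_ge0.
have cg0 : 0 <= c * g by apply: mulr_ge0.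
have k1 : 1 <= kappa by rewrite lerDl.
have k0 : 0 <= kappa by apply: le_trans k1.
have [alpha [D [a0 a1 D0 growth]]] := interval_energy_growth R kappa k1.
pose P := c * kappa.
have P0 : 0 <= P by apply: mulr_ge0.
have kP : 0 <= kappa * P by apply: mulr_ge0.
(* Up to [D], the squared norms of L, U, U^-1 and L^-1 get the constants [kappa], [kappa * P],
   [g * kappa] and [g * kappa * P]; the product in [E] dominates all four. *)
pose E := kappa * (1 + P) * (1 + g) * D.
have E0 : 0 < E by rewrite !mulr_gt0 //; lra.
(* The 4 counts the summands. Squared norms grow like n^alpha, so norms grow like n^(alpha / 2), and
   [alpha < 1] makes [p] exceed 2. *)
exists (4 * Num.sqrt E), (2 / alpha); split; first by rewrite mulr_gt0 ?sqrtr_gt0.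
split; first by rewrite ltr_pdivlMr //; lra.
rewrite invf_div => n M hM hu hinv.
have bM x : sqn (M *m x) <= c * sqn x by apply: sqn_mul_le.
have bMT x : sqn (M^T *m x) <= c * sqn x by apply: sqn_mul_trmx.
have bI j x : sqn (invmx (lead_sub M j) *m x) <= g * sqn x by apply: sqn_mul_le.
have stM : stable_below M g by apply: lead_sub_stable_below.
have stMT : stable_below M^T g.
  apply: lead_sub_stable_below => // j; rewrite lead_sub_trmx ?unitmx_tr //.
  by rewrite -trmx_inv; apply: sqn_mul_trmx.
have [L [U [MLU L1 Llow Uup [uL uU]]]] := LU_exists R n M hu.
have eL : M *m invmx U = L by rewrite MLU mulmxK.
have eU : M^T *m (invmx L)^T = U^T by rewrite -trmx_mul MLU mulKmx.
have iUup := inverse_upper_triangular R n U _ (mulVmx uU) Uup.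
have iLup : forall i j : 'I_n, (j < i)%N -> (invmx L)^T i j = 0.
  apply: (inverse_upper_triangular R n L^T).
    by rewrite -trmx_mul mulmxV // trmx1.
  by move=> i j ji; rewrite mxE Llow.
have NZL (i j : 'I_n) : (i < j)%N -> (M *m invmx U) i j = 0 by rewrite eL; apply: Llow.
have NZU (i j : 'I_n) : (i < j)%N -> (M^T *m (invmx L)^T) i j = 0.
  by move=> ij; rewrite eU mxE Uup.
(* The diagonal entries of U and U^-1 are reciprocal, so the lower bound on the latter bounds the
   former. This replaces the unit diagonal when the column bound is applied to [U^T]. *)
have pivot k : U k k ^+ 2 <= P.
  have := upper_factor_diag_bound _ _ M (invmx U) c g c0 g0 bM stM iUup NZL k.
  rewrite eL => /(_ (L1 k)); rewrite [g * c]mulrC -/kappa -/P => h.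
  have UZ : U k k * invmx U k k = 1.
    have := congr1 (fun A : 'M_n => A k k) (mulmxV uU); rewrite !mxE eqxx (bigD1 k) //=.
    rewrite big1 ?addr0 // => i ik.
    case: (ltngtP i k) => [ik'|ki|/val_inj e]; last by rewrite e eqxx in ik.
      by rewrite Uup ?mul0r.
    by rewrite iUup ?mulr0.
  have := ler_wpM2l (sqr_ge0 (U k k)) h.
  by rewrite mulr1 mulrCA -exprMn UZ expr1n mulr1.
pose w := n%:R `^ alpha.
have w0 : 0 <= w by apply: powR_ge0.
have bL x : sqn (L *m x) <= kappa * (D * w) * sqn x.
  apply: growth => // [a b y|k]; rewrite -eL.
    exact: lower_factor_interval_energy.
  have := lower_factor_col_bound _ _ M (invmx U) c g c0 g0 bM stM iUup NZL k.
  by rewrite {3}eL L1 expr1n mulr1.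
have bUT x : sqn (U^T *m x) <= kappa * P * (D * w) * sqn x.
  apply: growth => // [a b y|k]; rewrite -eU.
    exact: lower_factor_interval_energy.
  have := lower_factor_col_bound _ _ M^T _ c g c0 g0 bMT stMT iLup NZU k.
  rewrite {3}eU mxE; move/le_trans; apply.
  by rewrite ler_wpM2l.
have Dw0 : 0 <= D * w by rewrite mulr_ge0 // ltW.
(* Stability on the full index range plays the part of a bound on M^-1, applied to M U^-1 = L; the
   next bound does the same for M^T (L^-1)^T = U^T. *)
have biU x : sqn (invmx U *m x) <= g * kappa * (D * w) * sqn x.
  apply: le_trans (stable_below_sqn_le _ _ _ _ stM _) _; rewrite mulmxA eL.
  by rewrite -[leRHS]mulrA -[leRHS]mulrA ler_wpM2l // mulrA.
have biLT x : sqn ((invmx L)^T *m x) <= g * (kappa * P) * (D * w) * sqn x.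
  apply: le_trans (stable_below_sqn_le _ _ _ _ stMT _) _; rewrite mulmxA eU.
  by rewrite -[leRHS]mulrA -[leRHS]mulrA ler_wpM2l // mulrA.
have bU x : sqn (U *m x) <= kappa * P * (D * w) * sqn x.
  by rewrite -[U]trmxK; apply: sqn_mul_trmx => //; apply: mulr_ge0.
have biL x : sqn (invmx L *m x) <= g * (kappa * P) * (D * w) * sqn x.
  rewrite -[invmx L]trmxK; apply: sqn_mul_trmx => //.
  by apply: mulr_ge0 => //; apply: mulr_ge0.
pose W := Num.sqrt E * n%:R `^ (alpha / 2).
have W0 : 0 <= W by rewrite mulr_ge0 ?sqrtr_ge0 ?powR_ge0.
have W2 : W ^+ 2 = kappa * (1 + P) * (1 + g) * (D * w).
  rewrite exprMn sqr_sqrtr ?ltW // -powR_mulrn ?powR_ge0 // -powRrM divfK ?pnatr_eq0 //.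
  by rewrite /E -[LHS]mulrA.
have fin (A : 'M[R]_n) (s : R) : s <= kappa * (1 + P) * (1 + g) ->
    (forall x, sqn (A *m x) <= s * (D * w) * sqn x) -> specnorm A <= W.
  move=> hs hA; apply: specnorm_le => // x; apply: le_trans (hA x) _.
  by rewrite W2 ler_wpM2r ?sqn_ge0 // ler_wpM2r.
have Pg : 0 <= P * g by apply: mulr_ge0.
have kg : 0 <= kappa * g by apply: mulr_ge0.
have kPg : 0 <= kappa * (P * g) by apply: mulr_ge0.
exists L, U; do 6!split=> //.
have h1 : specnorm L <= W by apply: (fin _ kappa) => //; lra.
have h2 : specnorm U <= W by apply: (fin _ (kappa * P)) => //; lra.
have h3 : specnorm (invmx L) <= W by apply: (fin _ (g * (kappa * P))) => //; lra.
have h4 : specnorm (invmx U) <= W by apply: (fin _ (g * kappa)) => //; lra.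
rewrite -mulrA -/W; lra.
Qed.
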